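(* Let $k$ be a positive integer. Let $q_1,q_2,\ldots$ be positive integers such that $q_l\mid q_{l+1}$ and $q_l<q_{l+1}$ for all $l\geq 1$. Suppose that for every $C>0$ there exists $n=n(C)$ such that \[ \frac{\log q_{n+1}}{\log q_n}>C \quad\text{and}\quad \frac{\log q_{n+2}}{\log q_{n+1}}>k+1. \] Set $\zeta=\sum_{l\geq 1} \frac{1}{q_l}$. Then \begin{align*} \lambda_{k,j}(\zeta)&=\frac{1}{j-1}, \qquad 1\leq j\leq k+1,\\ \widehat{\lambda}_{k,1}(\zeta)&=\frac{1}{k},\\ \widehat{\lambda}_{k,j}(\zeta)&=0, \qquad 2\leq j\leq k+1. \end{align*}
   Context: For $\underline{\zeta}=(\zeta_1,\ldots,\zeta_k)\in\mathbb{R}^k$ and $1\leq j\leq k+1$, $\lambda_{k,j}(\underline{\zeta})$ (resp. $\widehat{\lambda}_{k,j}(\underline{\zeta})$) is the supremum of all $\eta\in\mathbb{R}$ such that the system $|x|\leq X$, $\max_{1\leq i\leq k}|\zeta_i x-y_i|\leq X^{-\eta}$ has at least $j$ linearly independent solutions $(x,y_1,\ldots,y_k)\in\mathbb{Z}^{k+1}$ for arbitrarily large real $X$ (resp. for all sufficiently large real $X$). For a real number $\zeta$ one writes $\lambda_{k,j}(\zeta):=\lambda_{k,j}(\zeta,\zeta^2,\ldots,\zeta^k)$ and $\widehat{\lambda}_{k,j}(\zeta):=\widehat{\lambda}_{k,j}(\zeta,\zeta^2,\ldots,\zeta^k)$. Convention: $1/0=\infty$ (so the case $j=1$ of the first line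 reads $\lambda_{k,1}(\zeta)=\infty$). *)

(* Defs.v *)
From HB Require Import structures.
From mathcomp Require Import all_boot all_order all_algebra.
From mathcomp Require Import all_classical all_reals all_analysis.
Set Implicit Arguments. Unset Strict Implicit. Unset Printing Implicit Defensive.
Import Order.TTheory GRing.Theory Num.Theory.
Local Open Scope classical_set_scope.
Local Open Scope ring_scope.

(* The system |x| <= X, max_i |z_i x - y_i| <= X^(-eta) has at least j
   linearly independent integer solutions (x, y_1, ..., y_k) in Z^(k+1).
   The j solutions are the rows (x r, y r 0, ..., y r (k-1)); linear
   independence = the j x (k+1) matrix of these rows has rank j. *)
Definition sol_cond {R : realType} (k j : nat) (z : 'I_k -> R) (X eta : R) : Prop :=
  exists (x : 'I_j -> int) (y : 'I_j -> 'I_k -> int),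
    (forall r : 'I_j, `|((x r)%:~R : R)| <= X /\
       forall i : 'I_k, `|z i * (x r)%:~R - (y r i)%:~R| <= X `^ (- eta))
    /\ \rank (row_mx (\matrix_(r < j, c < 1) ((x r)%:~R : R))
                     (\matrix_(r < j, i < k) ((y r i)%:~R : R))) = j.

Definition lambda_vec {R : realType} (k j : nat) (z : 'I_k -> R) : \bar R :=
  ereal_sup (EFin @` [set eta : R | forall X0 : R, exists X : R,
                         X0 <= X /\ @sol_cond R k j z X eta]).

Definition lambda_hat_vec {R : realType} (k j : nat) (z : 'I_k -> R) : \bar R :=
  ereal_sup (EFin @` [set eta : R | exists X0 : R, forall X : R,
                         X0 <= X -> @sol_cond R k j z X eta]).

Definition powvec {R : realType} (k : nat) (zeta : R) : 'I_k -> R :=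
  fun i => zeta ^+ (i.+1).

Definition lambda {R : realType} (k j : nat) (zeta : R) : \bar R :=
  @lambda_vec R k j (@powvec R k zeta).
Definition lambda_hat {R : realType} (k j : nat) (zeta : R) : \bar R :=
  @lambda_hat_vec R k j (@powvec R k zeta).

Definition zeta_of {R : realType} (q : nat -> nat) : R :=
  limn (fun n : nat => \sum_(1 <= l < n) ((q l)%:R : R)^-1).

(* Main.v *)
(** Put [N = q_n], [M = q_(n+1)] for an index [n] at which both gaps are large, [f]
    for the partial sum of the series up to [1/N], a fraction with denominator [N],
    and [g = f + 1/M].  Then [N] is a tiny power of [M], and [zeta] is within
    [2 / M^(k+1)] of [g].

    - Expanding [g^h = (f + 1/M)^h] and keeping the nonnegative powers of [M] in
      [N^k M^r g^h] gives, for [r = 0, ..., k], independent integer vectors with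
      [x = N^k M^r] and error [O(N^k / M)].  The first [j] of them yield
      [lambda_(k,j) >= 1/(j-1)].  The reverse inequality holds for every vector,
      because a [j x j] minor of [j] solutions is an integer of size
      [O(X^(1 - eta (j-1)))].
    - [lambda_hat_(k,1) >= 1/k] is Dirichlet's theorem.  If [p/q] is [g] in lowest
      terms, integers within [1/q] of [x (p/q)^h] for [h = 1, ..., k] force [q^k] to
      divide [x]; since [q >= M/N] is unbounded, [lambda_hat_(k,1) <= 1/k].
    - For [X] a large fixed power of [N], every solution lies on the line spanned by
      [(1, f, ..., f^k)], so [lambda_hat_(k,2) <= 0]. *)
Require Import Defs.
From mathcomp Require Import all_boot all_order all_algebra.
From mathcomp Require Import all_classical all_reals all_analysis.
From mathcomp Require Import perm ring lra zify.
Set Implicit Arguments.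
Unset Strict Implicit.
Unset Printing Implicit Defensive.
Import Order.TTheory GRing.Theory Num.Theory.
Import numFieldNormedType.Exports.
Local Open Scope classical_set_scope.
Local Open Scope ring_scope.

(** * Determinants and minors *)

Lemma ler_norm_det (R : realDomainType) (n : nat) (A : 'M[R]_n) (a b : 'I_n -> R) :
  (forall i j, `|A i j| <= a i * b j) ->
  `|\det A| <= n`!%:R * (\prod_i a i * \prod_j b j).
Proof.
move=> Aab; rewrite /determinant; apply: (le_trans (ler_norm_sum _ _ _)).
rewrite -card_Sn mulr_natl -sumr_const.
rewrite [leRHS](eq_bigl xpredT); last by move=> s; rewrite inE.
apply: ler_sum => s _.
rewrite normrM normrX normrN1 expr1n mul1r normr_prod.
rewrite [X in _ <= _ * X](reindex_inj (@perm_inj _ s)) -big_split /=.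
by apply: ler_prod => i _; rewrite normr_ge0 Aab.
Qed.

Lemma det_add_mulmx (R : comNzRingType) (n p : nat) (E : 'M[R]_n)
    (c : 'M[R]_(n, p)) (r : 'M[R]_(p, n)) :
  \det (E + c *m r) = \det (block_mx 1%:M r (- c) E).
Proof.
have elim_r : block_mx 1%:M r (- c) E *m block_mx 1%:M (- r) 0 1%:M =
    block_mx 1%:M 0 (- c) (E + c *m r).
  rewrite mulmx_block !mulmx0 !mulmx1 !mul1mx !addr0.
  by rewrite mulmxN mulNmx opprK addNr addrC.
have := congr1 determinant elim_r.
by rewrite det_mulmx det_ublock det_lblock !det1 !mul1r mulr1.
Qed.

(* Expanding [\det (E + c *m r)] itself leaves terms of order [(X * Z) ^+ n.+1], which
   only cancel; every term of the bordered determinant is small. *)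
Lemma ler_norm_det_add_rank1 (R : realFieldType) (n : nat) (E : 'M[R]_n.+1)
    (c : 'cV[R]_n.+1) (r : 'rV[R]_n.+1) (X Y Z : R) :
  0 < Y -> Y <= X * Z ->
  (forall i, `|c i 0| <= X) -> (forall j, `|r 0 j| <= Z) ->
  (forall i j, `|E i j| <= Y) ->
  `|\det (E + c *m r)| <= n.+2`!%:R * (X * Z * Y ^+ n).
Proof.
move=> Y0 YXZ cX rZ EY; rewrite det_add_mulmx.
pose a : 'cV[R]_(1 + n.+1) := col_mx (const_mx Z) (const_mx Y).
pose b : 'rV[R]_(1 + n.+1) := row_mx (const_mx (X / Y)) (const_mx 1).
apply: (le_trans (@ler_norm_det _ _ _ (a^~ 0) (b 0) _)).
  move=> i j; rewrite /a /b.
  case: (split_ordP i) => i' ->; case: (split_ordP j) => j' ->;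
    rewrite ?(block_mxEul, block_mxEur, block_mxEdl, block_mxEdr);
    rewrite ?(col_mxEu, col_mxEd, row_mxEl, row_mxEr) !mxE ?mulr1 ?ord1 //.
  - by rewrite normr1 mulrA ler_pdivlMr// mul1r mulrC.
  - by rewrite normrN mulrC divfK ?gt_eqF.
rewrite !big_split_ord /= !big_ord1 /a /b.
under eq_bigr do rewrite col_mxEd mxE.
under [X in _ * (_ * (_ * X))]eq_bigr do rewrite row_mxEr mxE.
rewrite col_mxEu row_mxEl !mxE !prodr_const card_ord expr1n exprS.
rewrite le_eqVlt; apply/orP; left; apply/eqP.
by field; rewrite gt_eqF.
Qed.

Lemma intmx_maximal_minor_ge1 (F : numFieldType) (m n : nat) (A : 'M[int]_(m, n)) :
  \rank (map_mx intr A : 'M[F]_(m, n)) = m ->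
  exists f : 'I_m -> 'I_n, 1 <= `|\det (colsub f (map_mx intr A : 'M[F]_(m, n)))|.
Proof.
move=> rkA.
have full : row_full (map_mx intr A : 'M[F]_(m, n))^T by rewrite /row_full mxrank_tr rkA.
exists (fullrankfun full).
have := fullrowsub_unit full.
rewrite -trmx_mxsub unitmx_tr unitmxE unitfE -map_mxsub det_map_mx.
by rewrite intr_eq0 -intr_norm ler1z -gtz0_ge1 normr_gt0.
Qed.

Lemma mxrank_colsub_unit (F : fieldType) (m n : nat) (f : 'I_m -> 'I_n)
    (A : 'M[F]_(m, n)) : colsub f A \in unitmx -> \rank A = m.
Proof.
move=> fA; apply/eqP; rewrite eqn_leq rank_leq_row /= -{1}(mxrank_unit fA).
rewrite (_ : colsub f A = A *m colsub f 1%:M) ?mxrankM_maxl//.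
by rewrite mulmx_colsub mulmx1.
Qed.

Lemma unitmx_trig (F : fieldType) (n : nat) (A : 'M[F]_n) :
  is_trig_mx A -> (forall i, A i i != 0) -> A \in unitmx.
Proof.
by move=> trigA A0; rewrite unitmxE det_trig// unitfE; apply/prodf_neq0 => i _.
Qed.

(** * Powers near a point and their Taylor expansions *)

Lemma ler_norm_subrXX (R : realDomainType) (h k : nat) (a b B : R) :
  `|a| <= B -> `|b| <= B -> 1 <= B -> (h <= k)%N ->
  `|a ^+ h - b ^+ h| <= k%:R * B ^+ k * `|a - b|.
Proof.
move=> aB bB B1 hk; rewrite subrXX normrM mulrC ler_wpM2r//.
apply: (le_trans (ler_norm_sum _ _ _)).
apply: (@le_trans _ _ (\sum_(i < h) B ^+ k)).
  apply: ler_sum => i _; rewrite normrM !normrX.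
  apply: (@le_trans _ _ (B ^+ (h.-1 - i) * B ^+ i)).
    by apply: ler_pM; rewrite ?exprn_ge0// lerXn2r ?nnegrE// (le_trans _ aB).
  rewrite -exprD; apply: ler_weXn2l => //.
  by have := ltn_ord i; lia.
rewrite sumr_const card_ord -[leLHS]mulr_natl ler_wpM2r ?ler_nat//.
by rewrite exprn_ge0// (le_trans ler01).
Qed.

Definition expr_lipschitz (R : realDomainType) (k : nat) (a : R) : R :=
  k%:R * (1 + `|a|) ^+ k.

Lemma expr_lipschitz_ge0 (R : realDomainType) (k : nat) (a : R) : 0 <= expr_lipschitz k a.
Proof. by rewrite mulr_ge0 ?exprn_ge0 ?addr_ge0. Qed.

Lemma ler_norm_subrXX_lipschitz (R : realDomainType) (h k : nat) (a b : R) :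
  `|b| <= `|a| -> (h <= k)%N -> `|a ^+ h - b ^+ h| <= expr_lipschitz k a * `|a - b|.
Proof.
by move=> ba; apply: ler_norm_subrXX; rewrite ?lerDl ?lerDr// (le_trans ba) ?lerDr.
Qed.

Lemma exprDn_nat (R : comPzRingType) (x y : R) (h m : nat) : (h < m)%N ->
  (x + y) ^+ h = \sum_(0 <= a < m) x ^+ (h - a) * y ^+ a *+ 'C(h, a).
Proof.
move=> hm; rewrite exprDn (big_cat_nat (leq0n h.+1) hm)//= big_mkord.
rewrite [X in _ = _ + X]big_nat_cond [X in _ = _ + X]big1 ?addr0//.
by move=> a /andP[/andP[ha _] _]; rewrite bin_small.
Qed.

Definition expr_taylor (R : comPzRingType) (n h : nat) (x t : R) : R :=
  \sum_(0 <= a < n.+1) x ^+ (h - a) * t ^+ a *+ 'C(h, a).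

Lemma expr_taylor0 (R : comPzRingType) (n : nat) (x t : R) : expr_taylor n 0 x t = 1.
Proof. by rewrite /expr_taylor -exprDn_nat// expr0. Qed.

Lemma expr_taylor_remainder (R : realDomainType) (n h : nat) (x t : R) :
  0 <= x -> 0 <= t <= 1 ->
  `|(x + t) ^+ h - expr_taylor n h x t| <= t ^+ n.+1 * (1 + x) ^+ h.
Proof.
move=> x0 /andP[t0 t1].
have hm : (h < (n + h).+1)%N by rewrite ltnS leq_addl.
have nm : (n.+1 <= (n + h).+1)%N by rewrite ltnS leq_addr.
have term_ge0 (s : R) a : 0 <= s -> 0 <= x ^+ (h - a) * s ^+ a *+ 'C(h, a).
  by move=> s0; rewrite mulrn_wge0// mulr_ge0 ?exprn_ge0.
rewrite [1 + x]addrC /expr_taylor !(exprDn_nat _ _ hm) !(big_cat_nat (leq0n n.+1) nm)//=.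
rewrite addrAC subrr add0r ger0_norm; last by apply: sumr_ge0 => a _; exact: term_ge0.
rewrite mulrDr ler_wpDl ?mulr_ge0 ?exprn_ge0 ?sumr_ge0//.
  by move=> a _; apply: term_ge0.
rewrite mulr_sumr !big_nat; apply: ler_sum => a /andP[na _].
rewrite expr1n mulr1 mulrnAr lerMn2r [leRHS]mulrC.
by rewrite ler_wpM2l ?exprn_ge0 ?ler_wiXn2l ?orbT.
Qed.

Lemma expr_taylor_unitmx (F : fieldType) (n : nat) (w : 'I_n -> F) (x t : F) :
  (forall i, w i != 0) -> t != 0 ->
  \matrix_(i < n, h < n) (w i * expr_taylor i h x t) \in unitmx.
Proof.
move=> w0 t0.
pose L : 'M[F]_n := \matrix_(i, a) (if (a <= i)%N then w i * t ^+ a else 0).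
pose U : 'M[F]_n := \matrix_(a, h) (x ^+ (h - a) *+ 'C(h, a)).
have -> : \matrix_(i < n, h < n) (w i * expr_taylor i h x t) = L *m U.
  apply/matrixP => i h; rewrite !mxE /expr_taylor big_mkord mulr_sumr.
  rewrite (big_ord_widen n (fun a => w i * (x ^+ (h - a) * t ^+ a *+ 'C(h, a))))//.
  rewrite big_mkcond /=; apply: eq_bigr => a _; rewrite !mxE ltnS.
  by case: ifP => _; rewrite ?mul0r// !mulrnAr -mulrA [t ^+ _ * _]mulrC.
rewrite unitmx_mul; apply/andP; split.
  apply: unitmx_trig => [|i]; last by rewrite mxE leqnn mulf_neq0 ?expf_neq0.
  by apply/is_trig_mxP => i a ia; rewrite mxE leqNgt ia.
rewrite -unitmx_tr; apply: unitmx_trig => [|a]; last first.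
  by rewrite !mxE binn subnn oner_neq0.
by apply/is_trig_mxP => a h ah; rewrite !mxE bin_small.
Qed.

(* The [h]-th coordinate of [N ^ k * M ^ r * (1, g, ..., g ^ k)], [g = P / N + 1 / M],
   with the negative powers of [M] dropped from its expansion. *)
Definition taylor_coord (F : fieldType) (k N M P r h : nat) : F :=
  N%:R ^+ k * M%:R ^+ r * expr_taylor r h (P%:R / N%:R) M%:R^-1.

Lemma taylor_coord0 (F : fieldType) (k N M P r : nat) :
  taylor_coord F k N M P r 0 = N%:R ^+ k * M%:R ^+ r.
Proof. by rewrite /taylor_coord expr_taylor0 mulr1. Qed.

Lemma taylor_coord_unitmx (F : numFieldType) (k N M P n : nat) :
  (0 < N)%N -> (0 < M)%N ->
  \matrix_(r < n, h < n) taylor_coord F k N M P r h \in unitmx.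
Proof.
move=> N0 M0; apply: expr_taylor_unitmx => [r|].
  by rewrite mulf_neq0// expf_neq0// pnatr_eq0 -lt0n.
by rewrite invr_eq0 pnatr_eq0 -lt0n.
Qed.

Lemma expr_mul_frac_int (F : archiNumFieldType) (k h N P : nat) :
  (0 < N)%N -> (h <= k)%N -> N%:R ^+ k * (P%:R / N%:R) ^+ h \is a @Num.int F.
Proof.
move=> N0 hk; rewrite -(subnK hk) exprD -mulrA -exprMn.
by rewrite [N%:R * _]mulrC divfK ?pnatr_eq0 -?lt0n// rpredM ?rpredX ?natr_int.
Qed.

Lemma taylor_coord_int (F : archiNumFieldType) (k N M P r h : nat) :
  (0 < N)%N -> (0 < M)%N -> (h <= k)%N -> taylor_coord F k N M P r h \is a Num.int.
Proof.
move=> N0 M0 hk; rewrite /taylor_coord /expr_taylor mulr_sumr big_nat.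
apply: rpred_sum => a /andP[_]; rewrite ltnS => ar.
rewrite mulrnAr mulrACA rpredMn// rpredM ?expr_mul_frac_int ?(leq_trans (leq_subr _ _))//.
by rewrite -div1r; exact: (expr_mul_frac_int F 1 M0 ar).
Qed.

Lemma taylor_coord_error (R : realFieldType) (k N M P r h : nat) : (0 < M)%N ->
  `|(P%:R / N%:R + M%:R^-1) ^+ h * (N%:R ^+ k * M%:R ^+ r) - taylor_coord R k N M P r h|
    <= (1 + P%:R / N%:R) ^+ h * (N%:R ^+ k / M%:R).
Proof.
move=> M0; have MR : 0 < M%:R :> R by rewrite ltr0n.
have M_inv : 0 <= (M%:R^-1 : R) <= 1 by rewrite invr_ge0 ler0n invf_le1// ler1n.
have f0 : 0 <= P%:R / N%:R :> R by rewrite divr_ge0.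
have x0 : 0 <= N%:R ^+ k * M%:R ^+ r :> R by rewrite mulr_ge0 ?exprn_ge0.
rewrite /taylor_coord [_ ^+ h * _]mulrC -mulrBr normrM (ger0_norm x0).
apply: (le_trans (ler_wpM2l x0 (expr_taylor_remainder r h f0 M_inv))).
rewrite le_eqVlt; apply/orP; left; apply/eqP.
by rewrite exprVn exprS; field; rewrite gt_eqF// expf_neq0 ?gt_eqF.
Qed.

(** * Integrality and simultaneous approximation *)

Lemma int_mul_norm_lt_eq0 (R : archiRealFieldType) (d t : R) :
  0 < d -> d * t \is a Num.int -> `|t| < d^-1 -> t = 0.
Proof.
move=> d0 dt_int; rewrite -[d^-1]mul1r ltr_pdivlMr// => td.
apply/eqP; apply: contraTT td => t0; rewrite -leNgt mulrC.
by rewrite -[d]gtr0_norm// -normrM norm_intr_ge1// mulf_neq0// gt_eqF.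
Qed.

(* By induction on the power: once [q ^ h] divides [x], the distance of
   [(p / q) ^ h.+1 * x] to an integer is a multiple of [1 / q]. *)
Lemma dvdz_expr_of_dist_lt (R : archiRealFieldType) (k p q : nat) (x : int)
    (y : 'I_k -> int) :
  (0 < q)%N -> coprime p q ->
  (forall i : 'I_k, `|(p%:R / q%:R) ^+ i.+1 * x%:~R - (y i)%:~R| < q%:R^-1 :> R) ->
  (q%:Z ^+ k %| x)%Z.
Proof.
move=> q0 pq close.
suff dvd_x h : (h <= k)%N -> (q%:Z ^+ h %| x)%Z by exact: dvd_x.
elim: h => [|h IHh] hk; first by rewrite expr0 dvd1z.
have /dvdzP[u xE] := IHh (ltnW hk).
have qR : 0 < q%:R :> R by rewrite ltr0n.
pose t : R := (p%:R / q%:R) ^+ h.+1 * x%:~R - (y (Ordinal hk))%:~R.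
have qtE : q%:R * t = (p%:Z ^+ h.+1 * u - q%:Z * y (Ordinal hk))%:~R.
  rewrite /t xE intrB !intrM !rmorphXn /= -!pmulrn expr_div_n !exprS.
  by field; rewrite expf_neq0 ?gt_eqF.
have t0 : t = 0.
  apply: (int_mul_norm_lt_eq0 qR); first by rewrite qtE intr_int.
  exact: close (Ordinal hk).
have : (q%:Z %| p%:Z ^+ h.+1 * u)%Z.
  move: qtE; rewrite t0 mulr0 => /esym/eqP; rewrite intr_eq0 subr_eq0 => /eqP ->.
  exact: dvdz_mulr.
rewrite Gauss_dvdzr; last by rewrite coprimezE abszX coprimeXr// coprime_sym.
by rewrite xE exprS => qu; exact: dvdz_mul.
Qed.

Lemma add_inv_reduced_frac (F : numFieldType) (N M P : nat) :
  (0 < M)%N -> (N %| M)%N ->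
  exists p q : nat, [/\ coprime p q, (0 < q <= M)%N, (M <= q * N)%N &
    p%:R / q%:R = P%:R / N%:R + M%:R^-1 :> F].
Proof.
move=> M0 /dvdnP[r ME]; move: M0; rewrite ME muln_gt0 => /andP[r0 N0].
pose a := (P * r + 1)%N; pose g := gcdn a (r * N).
have g0 : (0 < g)%N by rewrite gcdn_gt0 /a addn1.
have ga : (g %| a)%N by exact: dvdn_gcdl.
have gM : (g %| r * N)%N by exact: dvdn_gcdr.
have g_le_N : (g <= N)%N.
  apply: dvdn_leq => //; rewrite -(Gauss_dvdr _ (_ : coprime g r))//.
  by apply: coprime_dvdl ga _; rewrite coprime_sym /coprime gcdnMDl gcdn1.
have q0 : (0 < r * N %/ g)%N by rewrite divn_gt0// dvdn_leq// muln_gt0 r0.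
exists (a %/ g)%N, (r * N %/ g)%N; split.
- by rewrite /coprime -(eqn_pmul2r g0) muln_gcdl !divnK// mul1n.
- by rewrite q0 leq_div.
- by rewrite -{1}(divnK gM) leq_pmul2l.
have -> : P%:R / N%:R + (r * N)%:R^-1 = a%:R / (r * N)%:R :> F.
  by rewrite natrD !natrM; field; rewrite !pnatr_eq0 -!lt0n N0 r0.
rewrite -{2}(divnK ga) -{2}(divnK gM) !natrM.
by field; rewrite !pnatr_eq0 -!lt0n g0 q0.
Qed.

Lemma dist_floor_lt1 (R : archiRealDomainType) (a b : R) :
  `|a - b - (Num.floor a - Num.floor b)%:~R| < 1.
Proof.
have /andP[fa af] := floor_itv a; have /andP[fb bf] := floor_itv b.
by rewrite intrB ltr_norml; move: fa af fb bf; rewrite !intrD; lra.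
Qed.

(* Pigeonhole on the residues modulo [T] of [floor (T * z i * x)]. *)
Lemma dirichlet_approximation (R : archiRealFieldType) (k T n : nat) (z : 'I_k -> R) :
  (0 < T)%N -> (T ^ k <= n)%N ->
  exists (x : nat) (y : 'I_k -> int), (0 < x <= n)%N /\
    forall i, `|z i * x%:R - (y i)%:~R| < T%:R^-1.
Proof.
case: T => // T _ Tn; have TR : 0 < T.+1%:R :> R by rewrite ltr0n.
pose fl (x : 'I_n.+1) i : int := Num.floor (T.+1%:R * (z i * x%:R)).
pose F x : {ffun 'I_k -> 'I_T.+1} := [ffun i => inord `|(fl x i %% T.+1)%Z|].
have /injectivePn[x1 [x2 x12 Fx]] : ~~ injectiveb F.
  apply/negP => /injectiveP /leq_card.
  by rewrite card_ffun !card_ord leqNgt ltnS Tn.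
wlog lt12 : x1 x2 x12 Fx / (x1 < x2)%N.
  move=> ordered; have := x12; rewrite neq_ltn => /orP[lt12|lt21].
    exact: ordered lt12.
  by apply: ordered lt21; rewrite // eq_sym.
have fl_mod i : (T.+1 %| fl x2 i - fl x1 i)%Z.
  rewrite -eqz_mod_dvd; apply/eqP.
  have := congr1 (fun G : {ffun 'I_k -> 'I_T.+1} => val (G i)) Fx.
  have mod_lt m : (`|(m %% T.+1)%Z| < T.+1)%N by have := @ltz_pmod m T.+1 isT; lia.
  rewrite !ffunE /= !inordK//.
  by have := @modz_ge0 (fl x1 i) T.+1 isT; have := @modz_ge0 (fl x2 i) T.+1 isT; lia.
exists (x2 - x1)%N, (fun i => ((fl x2 i - fl x1 i) %/ T.+1)%Z); split.
  by rewrite subn_gt0 lt12 (leq_trans (leq_subr _ _))// -ltnS.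
move=> i; rewrite -[ltRHS]mul1r ltr_pdivlMr// -[X in _ * X < _](gtr0_norm TR) -normrM.
apply: le_lt_trans (dist_floor_lt1 (T.+1%:R * (z i * x2%:R)) (T.+1%:R * (z i * x1%:R))).
rewrite -/(fl x2 i) -/(fl x1 i) -[in leRHS](divzK (fl_mod i)) intrM.
rewrite -pmulrn natrB 1?ltnW// le_eqVlt; apply/orP; left; apply/eqP.
by congr (`|_|); ring.
Qed.

(** * Large parameters *)

Lemma near_pinfty_natr (R : realType) (Q : R -> Prop) :
  (\forall x \near +oo, Q x) -> \forall C \near \oo, forall n : nat, (C <= n)%N -> Q n%:R.
Proof.
move=> [A [_ QA]]; near=> C => n Cn; apply: QA.
apply: (@lt_le_trans _ _ C%:R); last by rewrite ler_nat.
by near: C; exact: nbhs_infty_gtr.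
Unshelve. all: by end_near.
Qed.

Lemma near_powR_gt (R : realType) (a b : R) : 0 < a -> \forall x \near +oo, b < x `^ a.
Proof.
move=> a0; near=> x.
apply: (@le_lt_trans _ _ ((`|b| `^ a^-1) `^ a)).
  by rewrite -powRrM mulVf ?gt_eqF// powRr1// ler_norm.
have bx : `|b| `^ a^-1 < x by near: x; exact: nbhs_pinfty_gt.
have x0 : 0 <= x by exact: le_trans (powR_ge0 _ _) (ltW bx).
by apply: gt0_ltr_powR; rewrite // nnegrE powR_ge0.
Unshelve. all: by end_near.
Qed.

Lemma near_powR_lt (R : realType) (a e : R) :
  a < 0 -> 0 < e -> \forall x \near +oo, x `^ a < e.
Proof.
move=> a0 e0; near=> x; rewrite -[a]opprK powRN invf_plt.
- by near: x; apply: near_powR_gt; rewrite oppr_gt0.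
- by rewrite posrE powR_gt0.
- by rewrite posrE.
Unshelve. all: by end_near.
Qed.

(* Any [s] strictly between [eta^-1] and [k] will do. *)
Lemma near_powR_window (R : realType) (k : nat) (eta c X0 : R) :
  (0 < k)%N -> k%:R^-1 < eta -> 0 < c -> exists s : R, \forall t \near +oo,
    [/\ X0 <= t `^ s, t `^ s * c <= t ^+ k & (t `^ s) `^ (- eta) < t^-1 / 2].
Proof.
move=> k0 eta_k c0; have kR : 0 < k%:R :> R by rewrite ltr0n.
have eta0 : 0 < eta by apply: lt_trans eta_k; rewrite invr_gt0.
have eta_inv_k : eta^-1 < k%:R by rewrite invf_plt.
pose s := (eta^-1 + k%:R) / 2.
have [eta_s s_k] : eta^-1 < s /\ s < k%:R by rewrite /s; split; lra.
have s0 : 0 < s by apply: lt_trans eta_s; rewrite invr_gt0.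
exists s; near=> t.
have t1 : 1 <= t by near: t; apply: nbhs_pinfty_ge; rewrite num_real.
have t0 : 0 < t by apply: lt_le_trans t1.
have powD a b : t `^ (a + b) = t `^ a * t `^ b by rewrite powRD// (gt_eqF t0) implybT.
split.
- by rewrite ltW//; near: t; exact: near_powR_gt.
- rewrite -powR_mulrn ?(ltW t0)// -[s](subrK k%:R) powD mulrAC ler_piMl ?powR_ge0//.
  rewrite -ler_pdivlMr// mul1r ltW//.
  by near: t; apply: near_powR_lt; rewrite ?subr_lt0// invr_gt0.
rewrite -powRrM -(@ltr_pM2l _ t)// mulrA divff ?gt_eqF// mul1r.
rewrite -{1}[t]powRr1 ?(ltW t0)// -powD.
by near: t; apply: near_powR_lt; rewrite ?invr_gt0// mulrN subr_lt0 -ltr_pdivrMr// div1r.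
Unshelve. all: by end_near.
Qed.

Lemma le_ereal_sup_EFin_itv (R : realType) (S : set R) (a b : R) : a < b ->
  (forall c, a <= c < b -> S c) -> (b%:E <= ereal_sup (EFin @` S))%E.
Proof.
move=> ab subS; apply/lee_addgt0Pr => e e0; rewrite -leeBlDr// -EFinB.
pose c := Num.max a (b - e).
apply: (@le_trans _ _ c%:E); first by rewrite lee_fin le_max lexx orbT.
apply: ereal_sup_ubound; exists c => //; apply: subS.
by rewrite le_max lexx gt_max ab gtrBl.
Qed.

(** * Solutions of the approximation system *)

Definition approx_solution (R : realType) (k : nat) (z : 'I_k -> R) (X eta : R)
    (x : int) (y : 'I_k -> int) : Prop :=
  `|x%:~R : R| <= X /\ forall i, `|z i * x%:~R - (y i)%:~R| <= X `^ (- eta).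

Section SolutionSystem.
Context {R : realType} {k : nat}.
Implicit Types (z : 'I_k -> R) (X eta : R) (j m : nat).

Lemma sol_cond_of_unitmx j z X eta (jk : (j <= k.+1)%N) (v : 'I_j -> 'I_k.+1 -> int) :
  (forall r, approx_solution z X eta (v r ord0) (fun i => v r (lift ord0 i))) ->
  \matrix_(r < j, c < j) (v r (widen_ord jk c))%:~R \in (unitmx : pred 'M[R]_j) ->
  sol_cond j z X eta.
Proof.
move=> sol unit_v; exists (v^~ ord0), (fun r i => v r (lift ord0 i)); split=> //.
apply: (@mxrank_colsub_unit _ _ _ (widen_ord jk : 'I_j -> 'I_(1 + k))).
congr (_ \in unitmx): unit_v; apply/matrixP => r c; rewrite !mxE.
case: split_ordP => c' cE; rewrite mxE; congr (v r _)%:~R; apply: val_inj.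
  by rewrite cE /= ord1.
by rewrite cE -[RHS]/(nat_of_ord _) lift0.
Qed.

Lemma sol_cond1_of_solution z X eta x y :
  x != 0 -> approx_solution z X eta x y -> sol_cond 1 z X eta.
Proof.
move=> x0 sol; pose v (_ : 'I_1) c := oapp y x (unlift ord0 c).
apply: (@sol_cond_of_unitmx 1 _ _ _ (ltn0Sn k) v).
  have [xX xy] := sol.
  by move=> r; rewrite /v unlift_none; split=> // i; rewrite liftK.
have w0 : widen_ord (ltn0Sn k) ord0 = ord0 by exact: val_inj.
rewrite unitmx_trig ?mx11_is_trig// => i.
by rewrite mxE /v ord1 w0 unlift_none/= intr_eq0.
Qed.

Lemma sol_cond_trivial j z X eta :
  X `^ (- eta) < 1 -> (forall x y, approx_solution z X eta x y -> x = 0) ->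
  sol_cond j z X eta -> j = 0%N.
Proof.
move=> Xeta x0 [x [y [sol <-]]].
have {}x0 r : x r = 0 by exact: x0 (sol r).
have y0 r i : y r i = 0.
  apply/eqP; apply: contraTT (Xeta) => y0; rewrite -leNgt.
  have [_ /(_ i)] := sol r; rewrite x0 mulr0 sub0r normrN; apply: le_trans.
  by rewrite norm_intr_ge1 ?intr_int ?intr_eq0.
apply/eqP; rewrite mxrank_eq0; apply/eqP/matrixP => r c.
by rewrite !mxE; case: split_ordP => c' _; rewrite mxE ?x0 ?y0.
Qed.

Lemma sol_cond_proportional j z X eta (w : 'I_k -> R) :
  (forall x y, approx_solution z X eta x y -> forall i, (y i)%:~R = w i * x%:~R) ->
  sol_cond j z X eta -> (j <= 1)%N.
Proof.
move=> prop [x [y [sol <-]]].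
have -> : row_mx (\matrix_(r < j, c < 1) ((x r)%:~R : R))
    (\matrix_(r < j, i < k) (y r i)%:~R) = (\col_r (x r)%:~R) *m row_mx 1%:M (\row_i w i).
  rewrite mul_mx_row mulmx1; congr row_mx; apply/matrixP => r c; rewrite !mxE//.
  by rewrite big_ord1 !mxE (prop _ _ (sol r)) mulrC.
by apply: (leq_trans (mxrankM_maxl _ _)); rewrite rank_leq_col.
Qed.

Lemma sol_cond_minor_bound m z X eta : 0 < X -> X `^ (- eta) <= X ->
  sol_cond m.+1 z X eta ->
  1 <= m.+2`!%:R * (X * (1 + \sum_i `|z i|) * (X `^ (- eta)) ^+ m).
Proof.
move=> X0 YX [x [y [sol rk]]].
pose A : 'M[int]_(m.+1, 1 + k) := row_mx (\matrix_(r, c) x r) (\matrix_(r, i) y r i).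
have AE : row_mx (\matrix_(r < m.+1, c < 1) ((x r)%:~R : R))
    (\matrix_(r < m.+1, i < k) (y r i)%:~R) = map_mx intr A.
  by rewrite map_row_mx; congr row_mx; apply/matrixP => r c; rewrite !mxE.
have [f detf] := intmx_maximal_minor_ge1 (etrans (congr1 mxrank (esym AE)) rk).
pose c : 'cV[R]_m.+1 := \col_r (x r)%:~R.
pose w : 'rV[R]_(1 + k) := row_mx 1%:M (\row_i z i).
pose E := colsub f (map_mx intr A) - c *m colsub f w.
apply: (le_trans detf); rewrite -[colsub f _](subrK (c *m colsub f w)) -/E.
have Z1 : 1 <= 1 + \sum_i `|z i| by rewrite lerDl sumr_ge0.
apply: ler_norm_det_add_rank1; first by rewrite powR_gt0.
- by apply: (le_trans YX); rewrite ler_peMr// ltW.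
- by move=> r; rewrite mxE; have [] := sol r.
- move=> i; rewrite mxE /w; case: (split_ordP (f i)) => c' ->.
    by rewrite row_mxEl mxE ord1 eqxx normr1.
  by rewrite row_mxEr mxE (bigD1 c')//= addrCA lerDl addr_ge0// sumr_ge0.
move=> r i; rewrite !mxE big_ord1 !mxE; case: split_ordP => c' _; rewrite !mxE.
  by rewrite (ord1 c') eqxx mulr1 subrr normr0 powR_ge0.
by rewrite mulrC distrC; have [_] := sol r; apply.
Qed.

Lemma approx_solution_transfer (zeta b X eta e : R) x (y : 'I_k -> int) :
  `|b| <= `|zeta| -> X `^ (- eta) < e / 2 ->
  expr_lipschitz k zeta * `|zeta - b| * X <= e / 2 ->
  approx_solution (@powvec R k zeta) X eta x y ->
  forall i : 'I_k, `|b ^+ i.+1 * x%:~R - (y i)%:~R| < e.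
Proof.
move=> b_zeta Xeta bX [xX xy] i.
have -> : b ^+ i.+1 * x%:~R - (y i)%:~R =
    (zeta ^+ i.+1 * x%:~R - (y i)%:~R) - (zeta ^+ i.+1 - b ^+ i.+1) * x%:~R by ring.
apply: (le_lt_trans (ler_normB _ _)); rewrite [e]splitr ltr_leD//.
  exact: le_lt_trans (xy i) Xeta.
rewrite normrM; apply: le_trans bX.
by apply: ler_pM => //; exact: ler_norm_subrXX_lipschitz.
Qed.

Lemma approx_solution_frac (N P : nat) (zeta X eta : R) x (y : 'I_k -> int) :
  let f : R := P%:R / N%:R in (0 < N)%N -> `|f| <= `|zeta| ->
  X `^ (- eta) < (N%:R ^+ k)^-1 / 2 ->
  expr_lipschitz k zeta * `|zeta - f| * X <= (N%:R ^+ k)^-1 / 2 ->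
  approx_solution (@powvec R k zeta) X eta x y ->
  forall i : 'I_k, (y i)%:~R = f ^+ i.+1 * x%:~R.
Proof.
move=> f N0 f_zeta Xeta fX sol i; apply/esym/eqP; rewrite -subr_eq0; apply/eqP.
apply: (@int_mul_norm_lt_eq0 _ (N%:R ^+ k)); first by rewrite exprn_gt0// ltr0n.
  by rewrite mulrBr mulrA rpredB// rpredM ?rpredX ?natr_int ?intr_int// expr_mul_frac_int.
exact: approx_solution_transfer f_zeta Xeta fX sol i.
Qed.

Lemma approx_solution_reduced_frac (p q : nat) (zeta X eta : R) x (y : 'I_k -> int) :
  let g : R := p%:R / q%:R in (0 < q)%N -> coprime p q -> `|g| <= `|zeta| ->
  X < q%:R ^+ k -> X `^ (- eta) < q%:R^-1 / 2 ->
  expr_lipschitz k zeta * `|zeta - g| * X <= q%:R^-1 / 2 ->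
  approx_solution (@powvec R k zeta) X eta x y -> x = 0.
Proof.
move=> g q0 pq g_zeta Xq Xeta gX sol.
have := dvdz_expr_of_dist_lt q0 pq (approx_solution_transfer g_zeta Xeta gX sol).
apply: contraTeq => x0; rewrite dvdzE abszX gtnNdvd ?absz_gt0//.
by rewrite -(ltr_nat R) natr_absz intr_norm natrX (le_lt_trans _ Xq)//; have [] := sol.
Qed.

Lemma lambda_vec_ge j z (a b : R) : a < b ->
  (forall eta, a <= eta < b -> forall X0, exists X, X0 <= X /\ sol_cond j z X eta) ->
  (b%:E <= lambda_vec j z)%E.
Proof. exact: le_ereal_sup_EFin_itv. Qed.

Lemma lambda_vec_le j z (b : R) :
  (forall eta, b < eta -> \forall X \near +oo, ~ sol_cond j z X eta) ->
  (lambda_vec j z <= b%:E)%E.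
Proof.
move=> nsol; apply: ge_ereal_sup => _ [eta /= sol <-]; rewrite lee_fin leNgt.
apply/negP => /nsol[A [_ nsolA]]; have [X [AX]] := sol (A + 1).
by apply: nsolA; apply: lt_le_trans AX; rewrite ltrDl.
Qed.

Lemma lambda_hat_vec_ge j z (a b : R) : a < b ->
  (forall eta, a <= eta < b -> \forall X \near +oo, sol_cond j z X eta) ->
  (b%:E <= lambda_hat_vec j z)%E.
Proof.
move=> ab sol; apply: (le_ereal_sup_EFin_itv ab) => eta /sol[A [_ solA]].
by exists (A + 1) => X AX; apply: solA; apply: lt_le_trans AX; rewrite ltrDl.
Qed.

Lemma lambda_hat_vec_le j z (b : R) :
  (forall eta X0, b < eta -> exists X, X0 <= X /\ ~ sol_cond j z X eta) ->
  (lambda_hat_vec j z <= b%:E)%E.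
Proof.
move=> nsol; apply: ge_ereal_sup => _ [eta /= [X0 sol] <-]; rewrite lee_fin leNgt.
by apply/negP => /(nsol _ X0)[X [/sol]].
Qed.

Lemma lambda_vec_le_inv m z : (0 < m)%N -> (lambda_vec m.+1 z <= (m%:R^-1)%:E)%E.
Proof.
move=> m0; have mR : 0 < m%:R :> R by rewrite ltr0n.
apply: lambda_vec_le => eta; rewrite -div1r ltr_pdivrMr// => eta_m.
have eta0 : 0 < eta by rewrite -(pmulr_lgt0 _ mR) (lt_trans _ eta_m).
pose K := m.+2`!%:R * (1 + \sum_i `|z i|).
have K0 : 0 < K.
  by rewrite mulr_gt0 ?ltr0n ?fact_gt0// ltr_wpDr// sumr_ge0.
near=> X.
have X1 : 1 <= X by near: X; apply: nbhs_pinfty_ge; rewrite num_real.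
have X0 : 0 < X by apply: lt_le_trans X1.
have Xeta : X `^ (- eta) < 1 by near: X; apply: near_powR_lt; rewrite ?oppr_lt0.
move=> /(sol_cond_minor_bound X0 (ltW (lt_le_trans Xeta X1))); apply/negP; rewrite -ltNge.
have -> : m.+2`!%:R * (X * (1 + \sum_i `|z i|) * X `^ (- eta) ^+ m) =
    K * X `^ (1 - eta * m%:R).
  rewrite -powR_mulrn ?powR_ge0// -powRrM mulNr powRD ?(gt_eqF X0) ?implybT//.
  by rewrite powRr1 ?ltW// /K; ring.
rewrite mulrC -ltr_pdivlMr// mul1r.
by near: X; apply: near_powR_lt; rewrite ?invr_gt0// subr_lt0.
Unshelve. all: by end_near.
Qed.

Lemma lambda_hat_vec_ge0 j z : (j <= k.+1)%N -> (0 <= lambda_hat_vec j z)%E.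
Proof.
move=> jk; apply: ereal_sup_ubound; exists 0 => //=; exists 1 => X X1.
pose v (r : 'I_j) (c : 'I_k.+1) : int :=
  if r == 0%N :> nat then oapp (fun i => Num.floor (z i)) 1 (unlift ord0 c)
  else (r == c :> nat)%:Z.
apply: (@sol_cond_of_unitmx _ _ _ _ jk v).
  move=> r; rewrite /v unlift_none /=; split.
    by case: eqP => _; rewrite ?normr1 ?normr0 ?(le_trans ler01).
  move=> i; rewrite oppr0 powRr0 liftK /=; case: eqP => _.
    rewrite mulr1 ger0_norm ?subr_ge0 ?floor_le_tmp// ltW//.
    by rewrite ltrBlDl -[1]/(1%:~R) -intrD floorD1_gt.
  by rewrite mulr0 sub0r normrN; case: eqP => _; rewrite ?normr1 ?normr0.
have vE (r c : 'I_j) : (c <= r)%N -> v r (widen_ord jk c) = (r == c)%:Z.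
  rewrite /v; case: eqP => // r0; rewrite r0 leqn0 => /eqP c0.
  have -> : widen_ord jk c = ord0 by exact: val_inj.
  by rewrite unlift_none -val_eqE /= r0 c0.
rewrite -unitmx_tr; apply: unitmx_trig => [|r]; last first.
  by rewrite !mxE vE// eqxx intr_eq0.
apply/is_trig_mxP => c r cr; rewrite !mxE vE ?(ltnW cr)//.
by rewrite -val_eqE /= gtn_eqF.
Qed.

Lemma lambda_hat_vec1_ge z : (0 < k)%N -> ((k%:R^-1)%:E <= lambda_hat_vec 1 z)%E.
Proof.
move=> k0; have kR : 0 < k%:R^-1 :> R by rewrite invr_gt0 ltr0n.
apply: (lambda_hat_vec_ge kR) => eta /andP[eta0 eta_k].
near=> X.
have X1 : 1 <= X by near: X; apply: nbhs_pinfty_ge; rewrite num_real.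
have X0 : 0 < X by apply: lt_le_trans X1.
pose U := X `^ k%:R^-1; pose T := Num.truncn U.
have U0 : 0 <= U by rewrite powR_ge0.
have U2 : 2 < U by rewrite /U; near: X; exact: near_powR_gt.
have UX : X `^ eta < U / 2.
  rewrite -[eta](subrK k%:R^-1) powRD ?(gt_eqF X0) ?implybT// mulrC.
  rewrite ltr_pM2l ?powR_gt0//.
  by near: X; apply: near_powR_lt; rewrite ?subr_lt0// invr_gt0.
have /andP[TU UT] := truncn_itv U0.
have TX : X `^ eta <= T%:R by move: UT; rewrite -natr1 -/T; lra.
have T0 : (0 < T)%N by rewrite truncn_gt0; lra.
have UkX : U ^+ k = X.
  by rewrite -powR_mulrn// -powRrM mulVf ?pnatr_eq0 -?lt0n// powRr1 ?ltW.
have Tk : (T ^ k <= Num.truncn X)%N.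
  by rewrite truncn_ge_nat ?(ltW X0)// natrX -UkX lerXn2r// nnegrE.
have [x [y [/andP[x0 xT] xy]]] := dirichlet_approximation z T0 Tk.
apply: (@sol_cond1_of_solution _ _ _ x%:Z y); first by rewrite eqz_nat -lt0n.
split.
  rewrite -pmulrn ger0_norm// (@le_trans _ _ (Num.truncn X)%:R) ?ler_nat//.
  by rewrite truncn_le ltW.
move=> i; apply: (le_trans (ltW (xy i))).
by rewrite powRN lef_pV2 ?posrE ?ltr0n// powR_gt0.
Unshelve. all: by end_near.
Qed.

End SolutionSystem.

(** * Numbers with large gaps *)

(* [N], [M] are consecutive denominators [q n], [q n.+1] and [P / N] is the
   partial sum of the series up to [1 / q n]. *)
Definition gap_approximation (R : realType) (k : nat) (zeta : R) (C N M P : nat) : Prop :=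
  [/\ (C < N)%N, (N %| M)%N, (N ^ C < M)%N &
      0 <= zeta - (P%:R / N%:R + M%:R^-1) <= 2 / M%:R ^+ k.+1].

Definition gap_approximable (R : realType) (k : nat) (zeta : R) : Prop :=
  forall C : nat, exists N M P : nat, gap_approximation k zeta C N M P.

Section GapApproximation.
Context {R : realType} {k : nat} {zeta : R}.
Implicit Types C N M P : nat.

Lemma gap_approximation_bounds C N M P : gap_approximation k zeta C N M P ->
  [/\ (0 < N)%N, (0 < M)%N, 0 <= P%:R / N%:R :> R &
      (P%:R / N%:R : R) <= P%:R / N%:R + M%:R^-1 <= zeta].
Proof.
move=> [CN _ CM /andP[gz _]].
have M0 : (0 < M)%N by exact: leq_ltn_trans CM.
split=> //; first exact: leq_ltn_trans CN.
by rewrite lerDl invr_ge0 ler0n -subr_ge0.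
Qed.

Lemma gap_approximation_dist C N M P : gap_approximation k zeta C N M P ->
  `|zeta - P%:R / N%:R| <= 3 / M%:R.
Proof.
move=> gap; have [_ M0 _ /andP[fg gz]] := gap_approximation_bounds gap.
have MR : 1 <= M%:R :> R by rewrite ler1n.
have [_ _ _ /andP[_ zg]] := gap.
have M_inv : (M%:R ^+ k.+1)^-1 <= M%:R^-1 :> R.
  rewrite lef_pV2 ?posrE ?exprn_gt0 ?(lt_le_trans ltr01)//.
  by rewrite exprS ler_peMr ?exprn_ege1.
rewrite ger0_norm ?subr_ge0 ?(le_trans fg)//.
by move: zg; rewrite (_ : zeta - _ = zeta - P%:R / N%:R - M%:R^-1); [lra|ring].
Qed.

Lemma gap_approximation_taylor C N M P (r h : nat) :
  gap_approximation k zeta C N M P -> (r <= k)%N -> (h <= k)%N ->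
  `|zeta ^+ h * (N%:R ^+ k * M%:R ^+ r) - taylor_coord R k N M P r h|
    <= (2 * expr_lipschitz k zeta + (1 + `|zeta|) ^+ k) * (N%:R ^+ k / M%:R).
Proof.
move=> gap rk hk; have [N0 M0 f0 /andP[fg gz]] := gap_approximation_bounds gap.
have [_ _ _ /andP[_ zg]] := gap; have tail := @taylor_coord_error R k N M P r h M0.
move: f0 fg gz zg tail; set f := P%:R / N%:R; set g := f + M%:R^-1.
set x := N%:R ^+ k * M%:R ^+ r; set V := taylor_coord _ _ _ _ _ _ _ => f0 fg gz zg tail.
have MR : 0 < M%:R :> R by rewrite ltr0n.
have g0 : 0 <= g by exact: le_trans fg.
have z0 : 0 <= zeta by exact: le_trans gz.
have x0 : 0 <= x by rewrite mulr_ge0 ?exprn_ge0.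
have -> : zeta ^+ h * x - V = (zeta ^+ h - g ^+ h) * x + (g ^+ h * x - V) by ring.
apply: (le_trans (ler_normD _ _)); rewrite [leRHS]mulrDl lerD//; last first.
  apply: (le_trans tail); rewrite ler_wpM2r ?mulr_ge0 ?exprn_ge0 ?invr_ge0//.
  apply: (@le_trans _ _ ((1 + `|zeta|) ^+ h)); last by rewrite ler_weXn2l// lerDl.
  by rewrite lerXn2r ?nnegrE ?addr_ge0// lerD2l ger0_norm// (le_trans fg).
have zeta_g : `|zeta ^+ h - g ^+ h| <= expr_lipschitz k zeta * (2 / M%:R ^+ k.+1).
  apply: le_trans (_ : expr_lipschitz k zeta * `|zeta - g| <= _).
    by apply: ler_norm_subrXX_lipschitz; rewrite // !ger0_norm.
  by rewrite ler_wpM2l ?expr_lipschitz_ge0// ger0_norm ?subr_ge0.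
rewrite normrM (ger0_norm x0); apply: (le_trans (ler_wpM2r x0 zeta_g)).
rewrite [leLHS](_ : _ = 2 * expr_lipschitz k zeta * (x / M%:R ^+ k.+1)); last by ring.
rewrite ler_wpM2l ?mulr_ge0 ?expr_lipschitz_ge0// -mulrA ler_wpM2l ?exprn_ge0//.
rewrite ler_pdivrMr ?exprn_gt0// exprSr mulrCA mulVf ?gt_eqF//.
by rewrite mulr1 ler_weXn2l// ler1n.
Qed.

Lemma gap_approximation_reduced C N M P : gap_approximation k zeta C.+1 N M P ->
  exists p q : nat, [/\ coprime p q, (C <= q)%N, (0 < q)%N &
    0 <= (p%:R / q%:R : R) <= zeta /\ zeta - p%:R / q%:R <= 2 / q%:R ^+ k.+1].
Proof.
move=> gap; have [CN NM CM /andP[gz zg]] := gap.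
have [N0 M0 _ _] := gap_approximation_bounds gap.
have [p [q [pq /andP[q0 qM] MqN pqE]]] := add_inv_reduced_frac R P M0 NM.
have CNq : (N ^ C < q)%N by rewrite -(ltn_pmul2r N0) -expnSr (leq_trans CM).
exists p, q; split=> //; last rewrite pqE; last split.
- by rewrite ltnW// (ltn_trans _ CNq)// ltn_expl// (leq_ltn_trans _ CN).
- by rewrite -[_ <= zeta]subr_ge0 gz andbT -pqE divr_ge0.
apply: (le_trans zg).
by rewrite ler_wpM2l// lef_pV2 ?posrE ?exprn_gt0 ?ltr0n// lerXn2r ?nnegrE ?ler_nat.
Qed.

Lemma near_gap_error_le (i : nat) (K eta : R) : 0 <= eta -> eta * i%:R < 1 ->
  \forall C \near \oo, forall N M, (C < N)%N -> (N ^ C < M)%N ->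
    K * (N%:R ^+ k / M%:R) <= (N%:R ^+ k * M%:R ^+ i) `^ (- eta).
Proof.
move=> eta0 eta_i; pose d := 1 - eta * i%:R; have d0 : 0 < d by rewrite subr_gt0.
near=> C => N M CN CM.
have NR : 1 < N%:R :> R.
  by rewrite ltr1n (leq_trans _ CN)// ltnS; near: C; exact: nbhs_infty_ge.
have KN : K <= N%:R.
  apply: (@le_trans _ _ C%:R); last by rewrite ler_nat ltnW.
  by near: C; exact: nbhs_infty_ger.
have Cd : 1 + k%:R + eta * k%:R <= C%:R * d.
  by rewrite -ler_pdivrMr//; near: C; exact: nbhs_infty_ger.
have [N0 MR] : 0 < N%:R :> R /\ 0 < M%:R :> R.
  by rewrite (lt_trans ltr01)// ltr0n (leq_ltn_trans _ CM).
apply: (@le_trans _ _ (N%:R * (N%:R ^+ k / M%:R))).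
  by rewrite ler_wpM2r// mulr_ge0 ?exprn_ge0 ?invr_ge0 ?ltW.
(* In logarithms the claim is linear in [ln N] and [ln M], and follows from
   [C * ln N <= ln M]. *)
have lnN0 : 0 <= ln N%:R :> R by rewrite ln_ge0// ltW.
have lnNM : C%:R * ln N%:R <= ln M%:R :> R.
  by rewrite mulr_natl -lnXn// ler_ln ?posrE ?exprn_gt0// -natrX ler_nat ltnW.
rewrite -ler_ln ?posrE ?powR_gt0 ?mulr_gt0 ?invr_gt0 ?exprn_gt0//.
rewrite ln_powR !lnM ?posrE ?mulr_gt0 ?invr_gt0 ?exprn_gt0// lnV ?posrE// !lnXn//.
rewrite -[_ *+ k]mulr_natl -[_ *+ i]mulr_natl.
have := ler_wpM2r lnN0 Cd; have := ler_wpM2l (ltW d0) lnNM.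
by rewrite mulrCA mulrA /d; lra.
Unshelve. all: by end_near.
Qed.

Lemma near_gap_window (eta K X0 : R) : 0 < eta ->
  \forall C \near \oo, forall N M, (C < N)%N -> (N ^ C < M)%N ->
    let X : R := N%:R `^ (k.+1%:R / eta) in
    [/\ X0 <= X, K * X * N%:R ^+ k <= M%:R & X `^ (- eta) < (N%:R ^+ k)^-1 / 2].
Proof.
move=> eta0; set s := k.+1%:R / eta; have s0 : 0 < s by rewrite divr_gt0 ?ltr0n.
near=> C => N M CN CM; set X : R := _ `^ s.
have N2 : (2 < N)%N by apply: leq_ltn_trans CN; near: C; exact: nbhs_infty_ge.
have NR : 0 < N%:R :> R by rewrite ltr0n (leq_trans _ N2).
split.
- rewrite ltW// /X.
  by move: (N) (ltnW CN); near: C; exact: near_pinfty_natr (near_powR_gt _ s0).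
- apply: (@le_trans _ _ (N%:R ^+ C)); last by rewrite -natrX ler_nat ltnW.
  apply: (@le_trans _ _ (N%:R * X * N%:R ^+ k)).
    rewrite !ler_wpM2r ?exprn_ge0 ?powR_ge0// (@le_trans _ _ C%:R) ?ler_nat 1?ltnW//.
    by near: C; exact: nbhs_infty_ger.
  rewrite -!powR_mulrn// -{1}[N%:R]powRr1// -!powRD ?(gt_eqF NR) ?implybT//.
  by rewrite ler_powR ?ler1n ?(leq_trans _ N2)//; near: C; exact: nbhs_infty_ger.
rewrite -powRrM mulrN divfK ?gt_eqF// powRN powR_mulrn// exprSr invfM.
by rewrite ltr_pM2l ?invr_gt0 ?exprn_gt0// ltf_pV2 ?posrE// ltr_nat.
Unshelve. all: by end_near.
Qed.

Hypothesis gap : gap_approximable k zeta.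

Lemma sol_cond_gap (i : nat) (eta X0 : R) :
  (0 < k)%N -> (i <= k)%N -> 0 <= eta -> eta * i%:R < 1 ->
  exists X, X0 <= X /\ sol_cond i.+1 (@powvec R k zeta) X eta.
Proof.
move=> k0 ik eta0 eta_i; near \oo => C.
have [N [M [P gapC]]] := gap C; have [CN _ CM _] := gapC.
have [N0 M0 _ _] := gap_approximation_bounds gapC.
have N1 : 1 <= N%:R :> R by rewrite ler1n.
have M1 : 1 <= M%:R :> R by rewrite ler1n.
pose V := taylor_coord R k N M P.
have V_int r (h : 'I_k.+1) : (Num.floor (V r h))%:~R = V r h :> R.
  by rewrite floorK// taylor_coord_int// -ltnS.
exists (V i 0%N); rewrite {1}/V taylor_coord0; split.
  apply: (@le_trans _ _ C%:R); first by near: C; exact: nbhs_infty_ger.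
  apply: (@le_trans _ _ (N%:R ^+ k)); last by rewrite ler_peMr ?exprn_ege1 ?exprn_ge0.
  by rewrite (@le_trans _ _ N%:R) ?ler_nat 1?ltnW// -{1}[N%:R]expr1 ler_weXn2l.
pose v (r : 'I_i.+1) (h : 'I_k.+1) := Num.floor (V r h).
apply: (@sol_cond_of_unitmx _ _ _ _ _ _ (ik : i < k.+1)%N v); rewrite /v.
  move=> r; have ri : (r <= i)%N by rewrite -ltnS.
  split=> [|h]; rewrite !V_int /V !taylor_coord0.
    by rewrite ger0_norm ?mulr_ge0 ?exprn_ge0// ler_wpM2l ?exprn_ge0// ler_weXn2l.
  rewrite lift0.
  apply: le_trans (gap_approximation_taylor gapC (leq_trans ri ik) (ltn_ord h)) _.
  by move: (N) (M) CN CM; near: C; exact: near_gap_error_le.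
under eq_mx do rewrite V_int /=.
exact: taylor_coord_unitmx.
Unshelve. all: by end_near.
Qed.

Lemma lambda_ge_gap (i : nat) (b : R) : (0 < k)%N -> (i <= k)%N ->
  0 < b -> b * i%:R <= 1 -> (b%:E <= lambda k i.+1 zeta)%E.
Proof.
move=> k0 ik b0 bi; apply: (lambda_vec_ge b0) => eta /andP[eta0 eta_b] X0.
apply: sol_cond_gap => //; have [->|i0] := posnP i; first by rewrite mulr0.
by apply: lt_le_trans bi; rewrite ltr_pM2r ?ltr0n.
Qed.

Lemma lambda_gap (i : nat) : (0 < k)%N -> (0 < i <= k)%N ->
  lambda k i.+1 zeta = (i%:R^-1)%:E.
Proof.
move=> k0 /andP[i0 ik]; have iR : 0 < i%:R :> R by rewrite ltr0n.
apply/eqP; rewrite eq_le lambda_vec_le_inv//= lambda_ge_gap ?invr_gt0//.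
by rewrite mulVf ?gt_eqF.
Qed.

Lemma lambda1_gap : (0 < k)%N -> lambda k 1 zeta = +oo%E.
Proof. by move=> k0; apply/eqyP => b b0; apply: lambda_ge_gap; rewrite ?mulr0. Qed.

Lemma lambda_hat1_le_gap : (0 < k)%N -> (lambda_hat k 1 zeta <= (k%:R^-1)%:E)%E.
Proof.
move=> k0; apply: lambda_hat_vec_le => eta X0 eta_k.
pose D : R := 2 + 4 * expr_lipschitz k zeta.
have lip0 := expr_lipschitz_ge0 k zeta.
have D2 : 2 <= D by rewrite lerDl mulr_ge0.
have [s near_s] := near_powR_window X0 k0 eta_k (lt_le_trans (ltr0Sn R 1) D2).
near \oo => C.
have [N [M [P /gap_approximation_reduced]]] := gap C.+1.
move=> [p [q [pq Cq q0 [/andP[g0 gz] zg]]]].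
have [X0q] : [/\ X0 <= q%:R `^ s, q%:R `^ s * D <= q%:R ^+ k &
    (q%:R `^ s) `^ (- eta) < q%:R^-1 / 2].
  by move: (q) Cq; near: C; exact: near_pinfty_natr near_s.
set X := q%:R `^ s => XD Xeta; exists X; split=> //.
have qR : 0 < q%:R :> R by rewrite ltr0n.
have X_gt0 : 0 < X by rewrite powR_gt0.
have Xeta1 : X `^ (- eta) < 1.
  apply: (lt_trans Xeta); rewrite -invfM invf_lt1 ?mulr_gt0//.
  by rewrite -natrM ltr1n (@leq_pmull 2).
suff x0 x y : approx_solution (@powvec R k zeta) X eta x y -> x = 0.
  by move=> /(sol_cond_trivial Xeta1 x0).
apply: approx_solution_reduced_frac (q0) (pq) _ _ Xeta _.
- by rewrite !ger0_norm// (le_trans g0).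
- by apply: lt_le_trans XD; rewrite ltr_pMr// (lt_le_trans _ D2)// ltr1n.
apply: (@le_trans _ _ (expr_lipschitz k zeta * (2 / q%:R ^+ k.+1) * X)).
  by rewrite ler_wpM2r ?(ltW X_gt0)// ler_wpM2l// ger0_norm ?subr_ge0.
have -> : expr_lipschitz k zeta * (2 / q%:R ^+ k.+1) * X =
    4 * expr_lipschitz k zeta * X / q%:R ^+ k * (q%:R^-1 / 2).
  by rewrite exprS; field; rewrite expf_neq0 ?gt_eqF.
rewrite ler_piMl ?mulr_ge0 ?invr_ge0// ler_pdivrMr ?exprn_gt0// mul1r.
by apply: le_trans XD; rewrite mulrC ler_wpM2l ?(ltW X_gt0)// /D; lra.
Unshelve. all: by end_near.
Qed.

Lemma lambda_hat_le0_gap (m : nat) : (lambda_hat k m.+2 zeta <= 0)%E.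
Proof.
apply: lambda_hat_vec_le => eta X0 eta0; near \oo => C.
have [N [M [P gapC]]] := gap C; have [CN _ CM _] := gapC.
have [N0 M0 f0 /andP[fg gz]] := gap_approximation_bounds gapC.
have [] : let X := N%:R `^ (k.+1%:R / eta) in
    [/\ X0 <= X, 6 * expr_lipschitz k zeta * X * N%:R ^+ k <= M%:R &
        X `^ (- eta) < (N%:R ^+ k)^-1 / 2].
  by move: (N) (M) CN CM; near: C; exact: near_gap_window.
set X := N%:R `^ _ => X0X XM Xeta; exists X; split=> //.
have NR : 0 < N%:R :> R by rewrite ltr0n.
have MR : 0 < M%:R :> R by rewrite ltr0n.
suff on_line x y : approx_solution (@powvec R k zeta) X eta x y ->
    forall i : 'I_k, (y i)%:~R = (P%:R / N%:R) ^+ i.+1 * x%:~R :> R.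
  by move=> /(sol_cond_proportional on_line).
apply: approx_solution_frac (N0) _ Xeta _.
  by rewrite !ger0_norm ?(le_trans fg)// (le_trans f0) ?(le_trans fg).
apply: (@le_trans _ _ (expr_lipschitz k zeta * (3 / M%:R) * X)).
  rewrite ler_wpM2r ?powR_ge0// ler_wpM2l ?expr_lipschitz_ge0//.
  exact: gap_approximation_dist gapC.
have -> : expr_lipschitz k zeta * (3 / M%:R) * X =
    6 * expr_lipschitz k zeta * X * N%:R ^+ k / M%:R * ((N%:R ^+ k)^-1 / 2).
  by field; rewrite expf_neq0 ?gt_eqF.
by rewrite ler_piMl ?mulr_ge0 ?invr_ge0 ?exprn_ge0// ler_pdivrMr// mul1r.
Unshelve. all: by end_near.
Qed.

End GapApproximation.

(** * The series of inverse denominators *)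

Lemma expn_lt_of_ln_ratio (R : realType) (a b C : nat) : (0 < a)%N -> (0 < b)%N ->
  C%:R < ln (b%:R : R) / ln (a%:R) -> (a ^ C < b)%N.
Proof.
move=> a0 b0 ratio.
have lna : 0 < ln (a%:R : R).
  rewrite lt_def ln_ge0 ?ler1n// andbT; apply: contraTN ratio => /eqP ->.
  by rewrite invr0 mulr0 -leNgt.
move: ratio; rewrite ltr_pdivlMr// mulr_natl -lnXn ?ltr0n//.
by rewrite ltr_ln ?posrE ?exprn_gt0 ?ltr0n// -natrX ltr_nat.
Qed.

Section DenominatorSeries.
Context {R : realType} (q : nat -> nat).
Hypothesis q_gt0 : forall l, (1 <= l)%N -> (0 < q l)%N.
Hypothesis q_step : forall l, (1 <= l)%N -> (q l %| q l.+1)%N /\ (q l < q l.+1)%N.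

Definition inv_partial_sum (n : nat) : R := \sum_(1 <= l < n) (q l)%:R^-1.

Lemma inv_partial_sumS n : inv_partial_sum n.+2 = inv_partial_sum n.+1 + (q n.+1)%:R^-1.
Proof. by rewrite /inv_partial_sum big_nat_recr. Qed.

Lemma inv_partial_sum_bounds n m : (1 <= n <= m)%N ->
  inv_partial_sum n <= inv_partial_sum m <= inv_partial_sum n + 2 / (q n)%:R.
Proof.
case: n m => [|n] [|m] //= nm.
have qR l : 0 < (q l.+1)%:R :> R by rewrite ltr0n q_gt0.
apply/andP; split.
  have /nondecreasing_seqP : forall l, inv_partial_sum l.+1 <= inv_partial_sum l.+2.
    by move=> l; rewrite inv_partial_sumS lerDl invr_ge0.
  exact.
pose v l := inv_partial_sum l.+1 + 2 / (q l.+1)%:R.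
apply: (@le_trans _ _ (v m)); first by rewrite lerDl divr_ge0.
have /nonincreasing_seqP : forall l, v l.+1 <= v l; last exact.
move=> l; rewrite /v inv_partial_sumS -addrA lerD2l.
have [/dvdnP[t qt] qlt] := q_step (ltn0Sn l).
have t2 : (2 <= t)%N by rewrite qt -{1}[q _]mul1n ltn_pmul2r ?q_gt0// in qlt.
have : 2 / (q l.+2)%:R <= (q l.+1)%:R^-1 :> R.
  rewrite qt natrM invfM mulrA ler_piMl ?invr_ge0//.
  by rewrite ler_pdivrMr ?mul1r ?ler_nat// ltr0n ltnW.
by lra.
Qed.

Lemma zeta_of_bounds n : (1 <= n)%N ->
  inv_partial_sum n <= zeta_of q <= inv_partial_sum n + 2 / (q n)%:R.
Proof.
move=> n1; have cvg_sum : cvgn inv_partial_sum.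
  apply: (near_nondecreasing_is_cvgn (M := inv_partial_sum 1 + 2 / (q 1)%:R)).
    near=> l => m lm; have l1 : (1 <= l)%N by near: l; exact: nbhs_infty_gt.
    by have /andP[] := @inv_partial_sum_bounds l m (introT andP (conj l1 lm)).
  near=> m; have m1 : (1 <= m)%N by near: m; exact: nbhs_infty_gt.
  by have /andP[] := @inv_partial_sum_bounds 1 m m1.
have bounds : \forall m \near \oo,
    inv_partial_sum n <= inv_partial_sum m <= inv_partial_sum n + 2 / (q n)%:R.
  by near=> m; apply: inv_partial_sum_bounds; rewrite n1; near: m; exact: nbhs_infty_ge.
by apply/andP; split; [apply: limr_ge|apply: limr_le] => //;
  apply: filterS bounds => m /andP[].
Unshelve. all: by end_near.
Qed.

Lemma denominator_dvd l n : (1 <= l <= n)%N -> (q l %| q n)%N.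
Proof.
move=> /andP[l1 /subnK <-]; elim: (n - l)%N => // d IHd; rewrite addSn.
by apply: (dvdn_trans IHd); have [] := @q_step (d + l) (leq_trans l1 (leq_addl _ _)).
Qed.

Lemma leq_denominator n : (1 <= n)%N -> (n <= q n)%N.
Proof.
elim: n => // -[_ _|n IHn _]; first exact: q_gt0.
by apply: (leq_ltn_trans (IHn isT)); have [] := @q_step n.+1 isT.
Qed.

Lemma inv_partial_sum_frac n : (1 <= n)%N ->
  exists P : nat, inv_partial_sum n.+1 = P%:R / (q n)%:R.
Proof.
move=> n1; exists (\sum_(1 <= l < n.+1) q n %/ q l)%N.
rewrite natr_sum mulr_suml; apply: eq_big_nat => l ln.
have qn : (q n)%:R != 0 :> R by rewrite pnatr_eq0 -lt0n q_gt0.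
by rewrite natf_div ?denominator_dvd// mulrAC mulfV// mul1r.
Qed.

Variable k : nat.
Hypothesis ln_gap : forall C : R, 0 < C -> exists n : nat, (1 <= n)%N /\
  ln ((q n.+1)%:R : R) / ln ((q n)%:R) > C /\
  ln ((q n.+2)%:R : R) / ln ((q n.+1)%:R) > k.+1%:R.

Lemma gap_subsequence (C : nat) : exists n : nat,
  [/\ (C < n)%N, (q n ^ C < q n.+1)%N & (q n.+1 ^ k.+1 < q n.+2)%N].
Proof.
pose ratio l : R := ln (q l.+1)%:R / ln (q l)%:R.
have ratio_ge0 l : (1 <= l)%N -> 0 <= ratio l.
  by move=> l1; rewrite divr_ge0// ln_ge0// ler1n q_gt0.
(* [A] dominates every ratio of index at most [C], which forces [C < n]. *)
pose A := C.+1%:R + \sum_(1 <= l < C.+1) ratio l.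
have sum0 : 0 <= \sum_(1 <= l < C.+1) ratio l.
  by rewrite big_nat; apply: sumr_ge0 => l /andP[l1 _]; exact: ratio_ge0.
have [|n [n1 [An kn]]] := @ln_gap A; first by rewrite ltr_wpDr.
have Cn : (C < n)%N.
  rewrite ltnNge; apply: contraTN An => nC; rewrite -leNgt ler_wpDl//.
  rewrite (bigD1_seq n) ?mem_index_iota ?n1 ?iota_uniq//= lerDl big_seq_cond.
  apply: sumr_ge0 => l /andP[]; rewrite mem_index_iota => /andP[l1 _] _.
  exact: ratio_ge0.
exists n; split=> //; apply: expn_lt_of_ln_ratio; rewrite ?q_gt0//; last exact: kn.
by apply: le_lt_trans An; rewrite ler_wpDr// ler_nat.
Qed.

Lemma zeta_of_gap_approximable : gap_approximable k (zeta_of q : R).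
Proof.
move=> C; have [n [Cn gapC gapk]] := gap_subsequence C.
have n1 : (1 <= n)%N by exact: leq_ltn_trans Cn.
have [P PE] := inv_partial_sum_frac n1.
exists (q n), (q n.+1), P; split=> //.
- exact: leq_trans (leq_denominator n1).
- by have [] := q_step n1.
have := @zeta_of_bounds n.+2 isT.
rewrite inv_partial_sumS // PE -lerBlDl -subr_ge0 => /andP[-> /le_trans]; apply.
rewrite ler_wpM2l// lef_pV2 ?posrE ?exprn_gt0 ?ltr0n ?q_gt0//.
by rewrite -natrX ler_nat ltnW.
Qed.

End DenominatorSeries.

Theorem theorem7 (R : realType) (k : nat) (q : nat -> nat) :
  (0 < k)%N ->
  (forall l, (1 <= l)%N -> (0 < q l)%N) ->
  (forall l, (1 <= l)%N -> (q l %| q l.+1)%N /\ (q l < q l.+1)%N) ->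
  (forall C : R, 0 < C -> exists n : nat, (1 <= n)%N /\
       ln ((q n.+1)%:R : R) / ln ((q n)%:R) > C /\
       ln ((q n.+2)%:R : R) / ln ((q n.+1)%:R) > k.+1%:R) ->
  let zeta : R := @zeta_of R q in
  (forall j : nat, (1 <= j <= k.+1)%N ->
     @lambda R k j zeta = (if j == 1%N then +oo%E else ((j.-1)%:R^-1 : R)%:E)) /\
  @lambda_hat R k 1 zeta = ((k%:R)^-1 : R)%:E /\
  (forall j : nat, (2 <= j <= k.+1)%N -> @lambda_hat R k j zeta = 0%E).
Proof.
move=> k0 q_gt0 q_step ln_gap zeta.
have gap : gap_approximable k zeta by exact: zeta_of_gap_approximable.
split; [|split].
- by case=> [|[|i]]//= ik; [exact: lambda1_gap|exact: lambda_gap].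
- by apply/eqP; rewrite eq_le lambda_hat1_le_gap//= lambda_hat_vec1_ge.
- case=> [|[|m]]// /andP[_ mk].
  by apply/eqP; rewrite eq_le lambda_hat_le0_gap//= lambda_hat_vec_ge0.
Qed.
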